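(* Let $r$ and $s$ be positive integers with $r \geq s \geq 3$. If $r \leq \lfloor \frac{5s-1}{3} \rfloor - 1$, then $f(s,r,3) = 9s - 7$.
   Context: For integers $a\le b$, $[a,b]=\{n\in\mathbb{N} : a\le n\le b\}$. For a finite set $X\subseteq\mathbb{N}$, $\mathrm{diam}(X)=\max(X)-\min(X)$. $f(s,r,3)$ denotes the smallest positive integer $n$ such that for every coloring $\Delta:[1,n]\to\{1,2,3\}$ there exist subsets $S_1,S_2\subseteq[1,n]$ with: (a) $S_1$ and $S_2$ each monochromatic (not necessarily of the same color); (b) $|S_1|=s$, $|S_2|=r$; (c) $\max(S_1)<\min(S_2)$; (d) $\mathrm{diam}(S_1)\le\mathrm{diam}(S_2)$. *)

(* Defs.v *)
From mathcomp Require Import all_boot.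
From mathcomp Require Export finmap.

Set Implicit Arguments.
Unset Strict Implicit.
Unset Printing Implicit Defensive.

Local Open Scope fset_scope.

Definition interval (a b : nat) : {fset nat} :=
  [fset x in iota a (b.+1 - a)].

Lemma in_interval (a b x : nat) : (x \in interval a b) = (a <= x <= b).
Proof.
rewrite /interval in_fset /= mem_iota.
case: (leqP a x) => //= ax.
have [ab|ba] := leqP a b.+1; first by rewrite subnKC // ltnS.
have /eqP -> : b.+1 - a == 0 by rewrite subn_eq0 ltnW.
by rewrite addn0 ltnNge ax leqNgt (leq_trans _ ax) // ltnW.
Qed.

(* On the empty set fset_max, fset_min and diam take the junk value 0. *)
Definition fset_max (X : {fset nat}) : nat := \max_(x <- X) x.

(* The default value fset_max X of the iterated minimum is itself an element
   of X when X is nonempty, so it does not affect the result. *)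
Definition fset_min (X : {fset nat}) : nat :=
  \big[minn/fset_max X]_(x <- X) x.

Definition diam (X : {fset nat}) : nat := fset_max X - fset_min X.

Definition monochromatic (n k : nat) (Delta : interval 1 n -> 'I_k)
    (S : {fset nat}) : Prop :=
  exists c : 'I_k, forall x : interval 1 n, fsval x \in S -> Delta x = c.

(* The k colors 1, ..., k are represented by the elements of 'I_k. *)
Definition forces_pair (s r k n : nat) : Prop :=
  forall Delta : interval 1 n -> 'I_k,
  exists S1 S2 : {fset nat},
    [/\ S1 `<=` interval 1 n /\ S2 `<=` interval 1 n,
        monochromatic Delta S1 /\ monochromatic Delta S2,
        #|` S1| = s /\ #|` S2| = r,
        fset_max S1 < fset_min S2
      & diam S1 <= diam S2].

(* f(s, r, k) = n: n is the smallest positive integer such that every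
   k-coloring of [1, n] admits the required pair of sets. *)
Definition f_eq (s r k n : nat) : Prop :=
  [/\ 0 < n, forces_pair s r k n
    & forall m : nat, 0 < m -> forces_pair s r k m -> n <= m].

(* Main.v *)
Require Import Defs.
From mathcomp Require Import all_boot.
From Stdlib Require Import Classical.
From mathcomp Require Import zify.

(** Upper bound.  The first [3s-2] integers contain a monochromatic [s]-set of
    diameter at most [3s-3]; so, if no pair exists, every color occurring at
    least [r] times (a "big" color) among the last [6s-5] integers spans at most
    [3s-3] of them.
    - One big color: it has at least [6s-3-2r >= s+r] elements, packed so
      tightly that its first [s] elements and the remaining ones form a pair.
    - Two big colors: the [s] first elements of the one that starts first
      precede the other color, whose span is at least as long.
    - Three big colors: the first and the last color have disjoint spans with a
      gap between them, filled by the third color, which must then start within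
      the first [s] elements; hence the last [2s-1] elements have the last
      color, while the first [2s-1] elements use only two colors.

    Lower bound.  With [t = s-1], the coloring
    [0 1^t 2^t 0^t 1^t 2^t 1^t 2^t 0^(2t)] of [1, 9s-8] has no such pair. *)

(** * Counting a color in half-open windows *)

Definition cnt {T : eqType} (col : nat -> T) (c : T) (a b : nat) : nat :=
  \sum_(a <= i < b) (col i == c).

(** The [s]-set lives in the half-open window [a, b) and the [r]-set has end
    points [x] and [y]; the conclusion is [y - x < b - 1 - a], written without
    truncated subtraction. *)
Definition avoids {T : eqType} (col : nat -> T) (s r lo hi : nat) : Prop :=
  forall (c1 c2 : T) (a b x y : nat),
    lo <= a -> b <= x -> x < y -> y < hi -> s <= cnt col c1 a b ->
    col x = c2 -> col y = c2 -> r <= cnt col c2 x y.+1 -> y + a.+1 < x + b.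

(** What the upper bound retains of the [s]-set found in the first [3s-2] integers, with
    [L = 3s-3]. *)
Definition short_spans {T : eqType} (col : nat -> T) (r L lo hi : nat) : Prop :=
  forall (c : T) (x y : nat),
    lo <= x -> x < y -> y < hi -> col x = c -> col y = c ->
    r <= cnt col c x y.+1 -> y - x < L.

Lemma cnt_cat {T : eqType} (col : nat -> T) c a m b :
  a <= m -> m <= b -> cnt col c a b = cnt col c a m + cnt col c m b.
Proof. by move=> am mb; rewrite /cnt (@big_cat_nat _ _ _ m). Qed.

Lemma cnt_geq {T : eqType} (col : nat -> T) c a b : b <= a -> cnt col c a b = 0.
Proof. by move=> ba; rewrite /cnt big_geq. Qed.

Lemma cnt1 {T : eqType} (col : nat -> T) c a : cnt col c a a.+1 = (col a == c).
Proof. by rewrite /cnt big_nat1. Qed.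

Lemma cnt_le {T : eqType} (col : nat -> T) c a b : cnt col c a b <= b - a.
Proof.
have -> : b - a = \sum_(a <= i < b) 1 by rewrite sum_nat_const_nat muln1.
by apply: leq_sum => i _; case: eqP.
Qed.

Lemma cnt_sub {T : eqType} (col : nat -> T) c a b a' b' :
  a <= a' -> b' <= b -> cnt col c a' b' <= cnt col c a b.
Proof.
move=> aa bb; have [ab|ab] := leqP a' b'; last by rewrite cnt_geq // ltnW.
rewrite (@cnt_cat _ _ _ a a' b) //; last lia.
by rewrite (@cnt_cat _ _ _ a' b' b) //; lia.
Qed.

Lemma cnt_partition {T : eqType} (col : nat -> T) c1 c2 c3 a b :
  uniq [:: c1; c2; c3] -> (forall x, col x \in [:: c1; c2; c3]) ->
  cnt col c1 a b + cnt col c2 a b + cnt col c3 a b = b - a.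
Proof.
move=> U H; rewrite /cnt -!big_split /=.
rewrite (eq_bigr (fun=> 1)) ?sum_nat_const_nat ?muln1 // => i _.
move: (H i) U; rewrite /= !inE.
by case/or3P => /eqP ->; rewrite !eqxx ?(eq_sym c2 c1) ?(eq_sym c3 c1)
  ?(eq_sym c3 c2); do 3 case: eqP.
Qed.

Lemma cnt_kth {T : eqType} (col : nat -> T) c k a b :
  0 < k -> k <= cnt col c a b ->
  exists x, [/\ a <= x, x < b, col x = c & cnt col c a x.+1 = k].
Proof.
move=> k0; elim: b => [|b IH] H; first by rewrite cnt_geq in H; lia.
have [ba|ab] := leqP b.+1 a; first by rewrite cnt_geq in H; lia.
have [/IH [x [ax xb cx ex]]|Hb] := leqP k (cnt col c a b).
  by exists x; split=> //; lia.
move: (H); rewrite (@cnt_cat _ _ _ a b) ?cnt1 //; try lia.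
case: eqP => [cb|]; last lia.
move=> H'; exists b; split=> //.
by rewrite (@cnt_cat _ _ _ a b) ?cnt1 ?cb ?eqxx //; lia.
Qed.

(** The points are the first and the last occurrence of [c]; the last one is the occurrence whose
    rank is the total count. *)
Lemma cnt_hull {T : eqType} (col : nat -> T) c a b :
  0 < cnt col c a b ->
  exists x y, [/\ a <= x, x <= y & y < b] /\
    [/\ col x = c, col y = c, cnt col c a x = 0, cnt col c y.+1 b = 0
      & cnt col c x y.+1 = cnt col c a b].
Proof.
move=> H.
have [x [ax xb cx ex]] := @cnt_kth _ col c 1 a b isT H.
have [y [ay yb cy ey]] := @cnt_kth _ col c _ a b H (leqnn _).
have x0 : cnt col c a x = 0.
  move: ex; rewrite (@cnt_cat _ _ _ a x) ?cnt1 ?cx ?eqxx //; lia.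
have xy : x <= y.
  rewrite leqNgt; apply/negP => yx.
  by have := @cnt_sub _ col c a x a y.+1 (leqnn _) yx; lia.
exists x, y; split=> //; split=> //.
  by move: ey; rewrite (@cnt_cat _ _ _ a y.+1 b) //; lia.
by rewrite -ey (@cnt_cat _ _ _ a x y.+1) ?x0 //; lia.
Qed.

(** Abstract names for the three colors let [palette_rot] and [palette_swap] permute their roles, so
    each case is treated for one arrangement only. *)
Definition palette {T : eqType} (col : nat -> T) (a b c : T) : Prop :=
  uniq [:: a; b; c] /\ forall x, col x \in [:: a; b; c].

Lemma palette_rot {T : eqType} (col : nat -> T) a b c :
  palette col a b c -> palette col b c a.
Proof.
case=> U H; split=> [|x]; first by rewrite -(rot_uniq 1) in U.
by move: (H x); rewrite -(mem_rot 1).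
Qed.

Lemma palette_swap {T : eqType} (col : nat -> T) a b c :
  palette col a b c -> palette col a c b.
Proof.
have E : perm_eq [:: a; b; c] [:: a; c; b].
  by rewrite perm_cons (perm_catC [:: b] [:: c]).
by case=> U H; split=> [|x]; rewrite -?(perm_uniq E) -?(perm_mem E).
Qed.

(** * Upper bound: a window of [6s-5] integers, by number of big colors *)

Section Window.
Context {T : eqType} (col : nat -> T) (s r lo hi : nat).

(** If [c] occurs [n] times, then [n >= 6s-3-2r >= s+r]. The last [n-s] occurrences have diameter at
    least [n-s-1]; as all of them span at most [3s-4], the first [s] have diameter at most [4s-4-n].
    This is no larger, because [2n >= 5s-3]. *)
Lemma one_big_color a b c :
  2 < s -> s <= r -> 3 * r <= 5 * s - 4 -> hi = lo + (6 * s - 5) ->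
  palette col a b c -> avoids col s r lo hi ->
  short_spans col r (3 * s - 3) lo hi ->
  cnt col a lo hi < r -> cnt col b lo hi < r -> False.
Proof.
move=> s3 sr r3 hiE [U H] AV SP ca cb.
have P i j := @cnt_partition _ _ _ _ _ i j U H.
have tot := P lo hi.
have [|x [y [[lox xy yhi] [cx cy c0 c1 ce]]]] :=
  @cnt_hull _ col c lo hi; first lia.
have le := cnt_le col c x y.+1.
have span : y - x < 3 * s - 3 by apply: (SP c) => //; lia.
have [||p [xp py cp ep]] := @cnt_kth _ col c s x y.+1; try lia.
have e2 : cnt col c x y.+1 = cnt col c x p.+1 + cnt col c p.+1 y.+1.
  by apply: cnt_cat; lia.
have [|u [v [[pu uv vy] [cu cv d0 d1 de]]]] :=
  @cnt_hull _ col c p.+1 y.+1; first lia.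
have le2 := cnt_le col c u v.+1.
have Q1 := P lo x; have Q2 := P x p.+1; have Q3 := P p.+1 y.+1.
have Q4 := P y.+1 hi.
have A1 := @cnt_cat _ col a lo x hi ltac:(lia) ltac:(lia).
have A2 := @cnt_cat _ col a x p.+1 hi ltac:(lia) ltac:(lia).
have A3 := @cnt_cat _ col a p.+1 y.+1 hi ltac:(lia) ltac:(lia).
have B1 := @cnt_cat _ col b lo x hi ltac:(lia) ltac:(lia).
have B2 := @cnt_cat _ col b x p.+1 hi ltac:(lia) ltac:(lia).
have B3 := @cnt_cat _ col b p.+1 y.+1 hi ltac:(lia) ltac:(lia).
suff : v + x.+1 < u + p.+1 by lia.
apply: (AV c c) => //; lia.
Qed.

Lemma two_big_ordered a b c xa ya xb yb :
  2 < s -> s <= r -> 3 * r <= 5 * s - 4 -> hi = lo + (6 * s - 5) ->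
  palette col a b c -> avoids col s r lo hi -> cnt col c lo hi < r ->
  r <= cnt col b xb yb.+1 ->
  lo <= xa -> xa < xb -> xa <= ya -> ya < hi -> xb <= yb -> yb < hi ->
  ya - xa < 3 * s - 3 -> yb - xb < 3 * s - 3 ->
  col xa = a -> col xb = b -> col yb = b ->
  cnt col a lo xa = 0 -> cnt col a ya.+1 hi = 0 ->
  cnt col b lo xb = 0 -> cnt col b yb.+1 hi = 0 -> False.
Proof.
move=> s3 sr r3 hiE [U H] AV nc nb loa xab xya yahi xyb ybhi sa sb.
move=> cxa cxb cyb a0 a1 b0 b1.
have P i j := @cnt_partition _ _ _ _ _ i j U H.
(* Otherwise only [c] occurs outside [[xa, ya]], that is, at least [3s-2 > r] times. *)
have yab : ya < yb.
  rewrite ltnNge; apply/negP => yba.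
  have Q1 := P lo xa; have Q2 := P ya.+1 hi.
  have C1 := @cnt_cat _ col c lo xa hi ltac:(lia) ltac:(lia).
  have C2 := @cnt_cat _ col c xa ya.+1 hi ltac:(lia) ltac:(lia).
  have B1 := @cnt_sub _ col b lo xb lo xa ltac:(lia) ltac:(lia).
  have B2 := @cnt_sub _ col b yb.+1 hi ya.+1 hi ltac:(lia) ltac:(lia).
  lia.
(* [[xa, e)] is the part of the hull of [a] that precedes [b]; the gap from [e] to [xb], if any,
   contains only [c]. *)
have [e [xae eb eya Hg]] : exists e, [/\ xa <= e, e <= xb, e <= ya.+1
    & cnt col c e xb = xb - e].
  have [h|h] := leqP ya.+1 xb.
    exists ya.+1; split => //; first lia.
    have Q := P ya.+1 xb.
    have B := @cnt_sub _ col b lo xb ya.+1 xb ltac:(lia) ltac:(lia).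
    have A := @cnt_sub _ col a ya.+1 hi ya.+1 xb ltac:(lia) ltac:(lia).
    lia.
  by exists xb; split; rewrite ?cnt_geq ?subnn //; lia.
(* Let [w] be the length of [[xb, yb]]. Outside [[xa, e)] and [[xb, yb]] only [c] occurs, at least
   [3s-2-w] times. As [c] occurs fewer than [r <= 2s-1] times in all, at most [w-s] of its elements
   lie in [[xa, e)], so the first [s] elements of color [a] fit into [w] consecutive positions. *)
have Q1 := P lo xa; have Q2 := P xa e; have Q3 := P yb.+1 hi.
have B1 := @cnt_sub _ col b lo xb lo xa ltac:(lia) ltac:(lia).
have B2 := @cnt_sub _ col b lo xb xa e ltac:(lia) ltac:(lia).
have A1 := @cnt_sub _ col a ya.+1 hi yb.+1 hi ltac:(lia) ltac:(lia).
have C1 := @cnt_cat _ col c lo xa hi ltac:(lia) ltac:(lia).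
have C2 := @cnt_cat _ col c xa e hi ltac:(lia) ltac:(lia).
have C3 := @cnt_cat _ col c e xb hi ltac:(lia) ltac:(lia).
have C4 := @cnt_cat _ col c xb yb.+1 hi ltac:(lia) ltac:(lia).
have [||p [xp pe cp ep]] := @cnt_kth _ col a s xa e; try lia.
have Q4 := P xa p.+1.
have C5 := @cnt_cat _ col c xa p.+1 e ltac:(lia) ltac:(lia).
have B3 := @cnt_sub _ col b lo xb xa p.+1 ltac:(lia) ltac:(lia).
have lb := cnt_le col b xb yb.+1.
suff : yb + xa.+1 < xb + p.+1 by lia.
apply: (AV a b) => //; lia.
Qed.

Lemma three_big_ends a b c :
  2 < s -> s <= r -> 3 * r <= 5 * s - 4 -> hi = lo + (6 * s - 5) ->
  palette col a b c -> avoids col s r lo hi ->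
  short_spans col r (3 * s - 3) lo hi ->
  r <= cnt col a lo hi -> r <= cnt col b lo hi -> r <= cnt col c lo hi ->
  col lo = a -> col hi.-1 = b -> False.
Proof.
move=> s3 sr r3 hiE [U H] AV SP na nb nc clo chi.
have P i j := @cnt_partition _ _ _ _ _ i j U H.
have [|xb [yb [[lxb xyb ybh] [cxb cyb b0 b1 be]]]] :=
  @cnt_hull _ col b lo hi; first lia.
have [|xa [ya [[lxa xya yah] [cxa cya a0 a1 ae]]]] :=
  @cnt_hull _ col a lo hi; first lia.
have [|xc [yc [[lxc xyc ych] [cxc cyc c0 c1 ce]]]] :=
  @cnt_hull _ col c lo hi; first lia.
have la := cnt_le col a xa ya.+1.
have lb := cnt_le col b xb yb.+1.
have lc := cnt_le col c xc yc.+1.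
have sa : ya - xa < 3 * s - 3 by apply: (SP a) => //; lia.
have sb : yb - xb < 3 * s - 3 by apply: (SP b) => //; lia.
have sc : yc - xc < 3 * s - 3 by apply: (SP c) => //; lia.
have xaE : xa = lo.
  have := cnt1 col a lo; rewrite clo eqxx => h1.
  case: (ltngtP xa lo) => // h2; first lia.
  by have := @cnt_sub _ col a lo xa lo lo.+1 ltac:(lia) ltac:(lia); lia.
have ybE : yb = hi.-1.
  have := cnt1 col b hi.-1; rewrite chi eqxx => h1.
  case: (ltngtP yb hi.-1) => // h2; last lia.
  have := @cnt_sub _ col b yb.+1 hi hi.-1 hi.-1.+1 ltac:(lia) ltac:(lia).
  by lia.
(* The span bounds give [ya <= lo + (3s-4)] and [xb >= lo + (3s-2)]. If [c] started after the first
   [s] elements, these would all have color [a] and form a pair with [c]. *)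
have [h|h] := leqP (lo + s) xc.
  have Q := P lo (lo + s).
  have C := @cnt_sub _ col c lo xc lo (lo + s) ltac:(lia) ltac:(lia).
  have B := @cnt_sub _ col b lo xb lo (lo + s) ltac:(lia) ltac:(lia).
  suff : yc + lo.+1 < xc + (lo + s) by lia.
  by apply: (AV a c) => //; lia.
have Q1 := P yc.+1 hi.
(* The position just before [xb] lies beyond [ya], so it has color [c]. *)
have gap : xb.-1 <= yc.
  rewrite leqNgt; apply/negP => hy.
  clear na nb nc la lb lc ae be ce xyc a0 c0 h.
  have Q := P xb.-1 xb.
  have A := @cnt_sub _ col a ya.+1 hi xb.-1 xb ltac:(lia) ltac:(lia).
  have B := @cnt_sub _ col b lo xb xb.-1 xb ltac:(lia) ltac:(lia).
  have C := @cnt_sub _ col c yc.+1 hi xb.-1 xb ltac:(lia) ltac:(lia).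
  lia.
have A1 := @cnt_sub _ col a ya.+1 hi yc.+1 hi ltac:(lia) ltac:(lia).
have yaxb : ya < xb by lia.
have ycub : yc <= lo + (4 * s - 5) by lia.
have xblb : lo + (3 * s - 2) <= xb by lia.
clear sa sb sc na nb nc la lb lc ae be ce xaE lxa xya yah a0 xyc lxc c0 h.
have [|u [v [[yu uv vh] [cu cv b2 b3 be2]]]] :=
  @cnt_hull _ col b yc.+1 hi; first lia.
have lu := cnt_le col b u v.+1.
have Q := P lo (lo + (2 * s - 1)).
have B := @cnt_sub _ col b lo xb lo (lo + (2 * s - 1)) ltac:(lia) ltac:(lia).
(* By [ycub] the last [2s-1 >= r] elements all have color [b], while the first [2s-1] avoid [b], so
   [a] or [c] occurs [s] times among them. *)
suff : v + lo.+1 < u + (lo + (2 * s - 1)) by lia.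
have [h2|h2] := leqP s (cnt col a lo (lo + (2 * s - 1))).
  by apply: (AV a b) => //; lia.
by apply: (AV c b) => //; lia.
Qed.

Lemma two_big_colors a b c :
  2 < s -> s <= r -> 3 * r <= 5 * s - 4 -> hi = lo + (6 * s - 5) ->
  palette col a b c -> avoids col s r lo hi ->
  short_spans col r (3 * s - 3) lo hi ->
  r <= cnt col a lo hi -> r <= cnt col b lo hi -> cnt col c lo hi < r -> False.
Proof.
move=> s3 sr r3 hiE pal AV SP na nb nc.
have [|xa [ya [[lxa xya yah] [cxa cya a0 a1 ae]]]] :=
  @cnt_hull _ col a lo hi; first lia.
have [|xb [yb [[lxb xyb ybh] [cxb cyb b0 b1 be]]]] :=
  @cnt_hull _ col b lo hi; first lia.
have la := cnt_le col a xa ya.+1.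
have lb := cnt_le col b xb yb.+1.
have sa : ya - xa < 3 * s - 3 by apply: (SP a) => //; lia.
have sb : yb - xb < 3 * s - 3 by apply: (SP b) => //; lia.
case: (ltngtP xa xb) => xab.
- by apply: (@two_big_ordered a b c xa ya xb yb) => //; rewrite be.
- have pal' := palette_swap _ _ _ _ (palette_rot _ _ _ _ pal).
  by apply: (@two_big_ordered b a c xb yb xa ya) => //; rewrite ae.
case: pal => /= /andP[+ _] _.
by rewrite !inE -cxa -cxb xab eqxx.
Qed.

Lemma three_big_colors a b c :
  2 < s -> s <= r -> 3 * r <= 5 * s - 4 -> hi = lo + (6 * s - 5) ->
  palette col a b c -> avoids col s r lo hi ->
  short_spans col r (3 * s - 3) lo hi ->
  r <= cnt col a lo hi -> r <= cnt col b lo hi -> r <= cnt col c lo hi ->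
  col lo = a -> False.
Proof.
move=> s3 sr r3 hiE pal AV SP na nb nc clo.
have := (proj2 pal) hi.-1; rewrite !inE => /or3P[]/eqP chi.
(* A color at both ends of the window would span [6s-6]. *)
- have : hi.-1 - lo < 3 * s - 3.
    apply: (SP a) => //; try lia.
    by rewrite prednK //; lia.
  lia.
- by apply: (@three_big_ends a b c).
by apply: (@three_big_ends a c b) => //; exact: palette_swap.
Qed.

Lemma short_spans_not_avoids a b c :
  2 < s -> s <= r -> 3 * r <= 5 * s - 4 -> hi = lo + (6 * s - 5) ->
  palette col a b c -> short_spans col r (3 * s - 3) lo hi ->
  ~ avoids col s r lo hi.
Proof.
move=> s3 sr r3 hiE pal SP AV.
have rot := palette_rot _ _ _ _ pal.
have rot2 := palette_rot _ _ _ _ rot.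
case: (leqP r (cnt col a lo hi)) => na; case: (leqP r (cnt col b lo hi)) => nb;
  case: (leqP r (cnt col c lo hi)) => nc.
- have := (proj2 pal) lo; rewrite !inE => /or3P[]/eqP clo.
  + exact: (@three_big_colors a b c).
  + exact: (@three_big_colors b c a).
  + exact: (@three_big_colors c a b).
- exact: (@two_big_colors a b c).
- exact: (@two_big_colors c a b).
- exact: (@one_big_color b c a).
- exact: (@two_big_colors b c a).
- exact: (@one_big_color c a b).
- exact: (@one_big_color a b c).
(* No color is big here; [one_big_color] still applies, since it only asks that two colors be
   small. *)
- exact: (@one_big_color a b c).
Qed.

End Window.

Lemma not_avoids {T : eqType} (col : nat -> T) s r a b c :
  2 < s -> s <= r -> 3 * r <= 5 * s - 4 -> palette col a b c ->
  ~ avoids col s r 1 (9 * s - 6).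
Proof.
move=> s3 sr r3 pal AV.
apply: (@short_spans_not_avoids _ col s r (3 * s - 1) (9 * s - 6) a b c) => //.
- lia.
- case: pal => U H; have Q := @cnt_partition _ col a b c 1 (3 * s - 1) U H.
  (* Pigeonhole on [3s-2 = 3(s-1)+1] elements; the [s]-set obtained has diameter at most [3s-3],
     which bounds every later span. *)
  have [d Hd] : exists d, s <= cnt col d 1 (3 * s - 1).
    case: (leqP s (cnt col a 1 (3 * s - 1))) => na; first by exists a.
    case: (leqP s (cnt col b 1 (3 * s - 1))) => nb; first by exists b.
    by exists c; lia.
  move=> e x y lx xy yh cx cy He.
  suff : y + 2 < x + (3 * s - 1) by lia.
  by apply: (AV d e) => //; lia.
by move=> d e a' b' x y la bx xy yh H1 cx cy H2; apply: (AV d e) => //; lia.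
Qed.

(** * From counts to finite sets and back *)

Lemma cnt_count {T : eqType} (col : nat -> T) c a b :
  cnt col c a b = size [seq x <- index_iota a b | col x == c].
Proof.
rewrite /cnt size_filter -sum1_count [RHS]big_mkcond.
by apply: eq_bigr => i _; case: eqP.
Qed.

Lemma subset_of_cnt {T : eqType} (col : nat -> T) c k a b :
  k <= cnt col c a b ->
  exists S : {fset nat}, #|` S|%fset = k /\
    forall x, x \in S -> a <= x < b /\ col x = c.
Proof.
rewrite cnt_count; set l := filter _ _ => kl.
have ul : uniq (take k l) by rewrite take_uniq // filter_uniq // iota_uniq.
exists [fset x in take k l]%fset; split.
  by rewrite card_fseq undup_id // size_takel.
move=> x; rewrite in_fset /= => /mem_take.
by rewrite mem_filter mem_index_iota => /andP[/eqP].
Qed.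

Lemma card_le_cnt {T : eqType} (col : nat -> T) c (S : {fset nat}) a b :
  (forall x, x \in S -> a <= x < b /\ col x = c) ->
  #|` S|%fset <= cnt col c a b.
Proof.
move=> H; rewrite cnt_count; apply: uniq_leq_size; first exact: fset_uniq.
move=> x xS; have [h /eqP e] := H x xS.
by rewrite mem_filter e mem_index_iota.
Qed.

Lemma fset_max_ge (S : {fset nat}) x : x \in S -> x <= fset_max S.
Proof. by move=> xS; rewrite /fset_max; apply: leq_bigmax_seq. Qed.

Lemma fset_max_in (S : {fset nat}) x : x \in S -> fset_max S \in S.
Proof.
rewrite /fset_max.
have E z : (z \in S) = (z \in enum_fset S) by [].
rewrite !E; elim: (enum_fset S) x => // y [_|z l IH] x _.
  by rewrite big_seq1 inE.
rewrite big_cons inE /maxn; case: ifP => _; last by rewrite eqxx.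
by rewrite (IH z) ?orbT // inE eqxx.
Qed.

Lemma fset_min_le (S : {fset nat}) x : x \in S -> fset_min S <= x.
Proof.
rewrite /fset_min; move: (fset_max S) => m.
have -> : (x \in S) = (x \in enum_fset S) by [].
elim: (enum_fset S) => //= y l IH; rewrite big_cons inE geq_min.
by case/orP => [/eqP ->|/IH ->]; rewrite ?leqnn ?orbT.
Qed.

Lemma fset_min_in (S : {fset nat}) x : x \in S -> fset_min S \in S.
Proof.
move=> /fset_max_in maxS; rewrite /fset_min big_seq.
apply: (big_ind (fun z => z \in S)) => // u v uS vS.
by rewrite /minn; case: ifP.
Qed.

(** Both end points are put into the set and only [k - 2] elements are chosen strictly between them,
    so the diameter is exactly [y - x]. *)
Lemma cnt_span_subset {T : eqType} (col : nat -> T) c k x y :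
  1 < k -> x < y -> col x = c -> col y = c -> k <= cnt col c x y.+1 ->
  exists S : {fset nat}, [/\ #|` S|%fset = k, x \in S, y \in S
    & forall z, z \in S -> x <= z <= y /\ col z = c].
Proof.
move=> k1 xy cx cy.
rewrite (@cnt_cat _ col c x x.+1 y.+1) //; last exact: ltnW.
rewrite (@cnt_cat _ col c x.+1 y y.+1) //.
rewrite !cnt1 cx cy eqxx => H.
have [|S [cS HS]] := @subset_of_cnt _ col c (k - 2) x.+1 y; first lia.
exists (x |` (y |` S))%fset; split.
- rewrite !cardfsU1 in_fset1U cS.
  have -> : x \in S = false by apply/negP => /HS[]; lia.
  have -> : y \in S = false by apply/negP => /HS[]; lia.
  by have -> : (x == y) = false; lia.
- by rewrite in_fset1U eqxx.
- by rewrite !in_fset1U eqxx orbT.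
move=> z; rewrite !in_fset1U => /or3P[/eqP->|/eqP->|/HS[h ?]]; split=> //; lia.
Qed.

Lemma fset_max_min_bounds (S : {fset nat}) a b :
  0 < #|` S|%fset -> (forall z, z \in S -> a <= z <= b) ->
  a <= fset_min S /\ fset_max S <= b.
Proof.
rewrite cardfs_gt0 => /fset0Pn[z zS] H.
have := H _ (fset_max_in _ _ zS); have := H _ (fset_min_in _ _ zS); lia.
Qed.

Lemma forces_of_not_avoids s r k n : 0 < s -> 1 < r ->
  (forall col : nat -> 'I_k.+1, ~ avoids col s r 1 n.+1) ->
  forces_pair s r k.+1 n.
Proof.
move=> s0 r1 H Delta.
(* The color [ord0] outside the interval is arbitrary: [avoids] only inspects [[1, n+1)]. *)
pose col x : 'I_k.+1 := if insub x is Some u then Delta u else ord0.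
have colE (u : interval 1 n) : col (val u) = Delta u by rewrite /col valK.
apply: NNPP => NP; apply: (H col) => c1 c2 a b x y a1 bx xy yn H1 cx cy H2.
rewrite ltnNge; apply/negP => le; apply: NP.
have [S1 [card1 S1P]] := @subset_of_cnt _ _ _ _ _ _ H1.
have [S2 [card2 xS yS S2P]] := @cnt_span_subset _ _ _ _ _ _ r1 xy cx cy H2.
have [|z /S1P|m1 M1] := @fset_max_min_bounds S1 a b.-1; [lia | lia |].
have [|z /S2P|m2 M2] := @fset_max_min_bounds S2 x y; [lia | lia |].
have M2' := fset_max_ge _ _ yS; have m2' := fset_min_le _ _ xS.
have s1 := leq_trans H1 (cnt_le _ _ _ _).
exists S1, S2; split => //; rewrite /diam; try lia.
- by split; apply/fsubsetP => z zS; rewrite in_interval;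
    [have := S1P z zS | have := S2P z zS]; lia.
by split; [exists c1 | exists c2] => u uS; rewrite -colE;
  [have [] := S1P _ uS | have [] := S2P _ uS].
Qed.

(** [avoids] with [s] in place of [r] is the stronger demand, so a single coloring serves every
    [r >= s] and every [m <= n]. *)
Lemma not_forces_of_avoids k s r n m (col : nat -> 'I_k) :
  1 < s -> s <= r -> m <= n -> avoids col s s 1 n.+1 -> ~ forces_pair s r k m.
Proof.
move=> s1 sr mn AV /(_ (fun u => col (val u))).
case=> S1 [S2 [[/fsubsetP I1 /fsubsetP I2]
  [[c1 C1] [c2 C2]] [card1 card2] lt le]].
have /fset0Pn[z1 z1S] : S1 != fset0 by rewrite -cardfs_gt0 card1; lia.
have /fset0Pn[z2 z2S] : S2 != fset0 by rewrite -cardfs_gt0 card2; lia.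
have M1 := fset_max_in _ _ z1S; have m1 := fset_min_in _ _ z1S.
have M2 := fset_max_in _ _ z2S; have m2 := fset_min_in _ _ z2S.
have D1 z (zS : z \in S1) : col z = c1 by exact: (C1 [` I1 z zS]%fset).
have D2 z (zS : z \in S2) : col z = c2 by exact: (C2 [` I2 z zS]%fset).
have B1 : #|` S1|%fset <= cnt col c1 (fset_min S1) (fset_max S1).+1.
  apply: card_le_cnt => z zS; split; last exact: D1.
  by rewrite fset_min_le // ltnS fset_max_ge.
have B2 : #|` S2|%fset <= cnt col c2 (fset_min S2) (fset_max S2).+1.
  apply: card_le_cnt => z zS; split; last exact: D2.
  by rewrite fset_min_le // ltnS fset_max_ge.
have l1 := leq_trans B1 (cnt_le _ _ _ _).
have l2 := leq_trans B2 (cnt_le _ _ _ _).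
have := I1 _ m1; have := I2 _ M2; rewrite !in_interval => b2 b1.
suff : fset_max S2 + (fset_min S1).+1 < fset_min S2 + (fset_max S1).+1.
  by move: le; rewrite /diam; lia.
apply: (AV c1 c2) => //; try exact: D2; lia.
Qed.

(** * Lower bound: the extremal coloring *)

Definition extremal (t x : nat) : 'I_3 :=
  if x <= 1 then @Ordinal 3 0 isT else
  if x <= t + 1 then @Ordinal 3 1 isT else
  if x <= 2 * t + 1 then @Ordinal 3 2 isT else
  if x <= 3 * t + 1 then @Ordinal 3 0 isT else
  if x <= 4 * t + 1 then @Ordinal 3 1 isT else
  if x <= 5 * t + 1 then @Ordinal 3 2 isT else
  if x <= 6 * t + 1 then @Ordinal 3 1 isT else
  if x <= 7 * t + 1 then @Ordinal 3 2 isT else @Ordinal 3 0 isT.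

(** Closed form of the count on [[0, n)]: [minn (n - p) t] is the contribution of a block of length
    [t] starting at [p]. The term [minn n 2] is due to position 0, which [extremal] also gives color
    0. *)
Definition extremal_prefix (t : nat) (c : 'I_3) (n : nat) : nat :=
  match val c with
  | 0 => minn n 2 + minn (n - (2 * t + 2)) t + (n - (7 * t + 2))
  | 1 => minn (n - 2) t + minn (n - (3 * t + 2)) t + minn (n - (5 * t + 2)) t
  | _ => minn (n - (t + 2)) t + minn (n - (4 * t + 2)) t
         + minn (n - (6 * t + 2)) t
  end.

Lemma cnt_extremal t c n : cnt (extremal t) c 0 n = extremal_prefix t c n.
Proof.
elim: n => [|n IH].
  rewrite cnt_geq // /extremal_prefix.
  by case: c => -[|[|[|//]]] /= _; lia.
rewrite (@cnt_cat _ _ _ 0 n) // cnt1 IH /extremal_prefix /extremal -val_eqE.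
case: c {IH} => -[|[|[|//]]] /= _.
all: do 8 (case: leqP => ? /=; first lia); lia.
Qed.

(** Only the final run has more than [t] elements, so [t+1] elements of one color either straddle
    two blocks, with diameter at least [3t] or, ending at [5t+2] or later, at least [2t], or they
    lie in the final run. *)
Lemma extremal_left t c a b :
  1 < t -> 0 < a -> t < cnt (extremal t) c a b ->
  3 * t + 1 < b /\ a + 3 * t < b \/ 5 * t + 2 < b /\ a + 2 * t < b \/
  8 * t + 2 < b.
Proof.
move=> t1 a0 H.
have ab : a <= b.
  by have := leq_trans H (cnt_le _ _ _ _); lia.
have := @cnt_cat _ (extremal t) c 0 a b isT ab; rewrite !cnt_extremal.
case: c H => -[|[|[|//]]] i; rewrite /extremal_prefix /= => H E; lia.
Qed.

Lemma extremal_tail t x : 3 * t + 1 < x ->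
  val (extremal t x) = 0 /\ 7 * t + 1 < x \/
  val (extremal t x) = 1 /\ x <= 6 * t + 1 \/
  val (extremal t x) = 2 /\
    (4 * t + 1 < x <= 5 * t + 1 \/ 6 * t + 1 < x <= 7 * t + 1).
Proof.
move=> xt; move E: (val (extremal t x)) => v; move: E; rewrite /extremal.
do 8 (case: ifP => ? /=; first by lia); lia.
Qed.

(** Beyond [3t+1] the pattern is [1^t 2^t 1^t 2^t 0^(2t)]: colors 1 and 2 extend over [3t] integers
    each, color 0 over [2t]. Past [5t+2] colors 1 and 2 have at most [t] elements left, so only
    color 0 remains possible. *)
Lemma extremal_right t c x y :
  3 * t + 1 < x -> y <= 9 * t + 1 ->
  extremal t x = c -> extremal t y = c -> t < cnt (extremal t) c x y.+1 ->
  [/\ y < x + 3 * t, 5 * t + 2 < x -> y < x + 2 * t & x < 8 * t + 3].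
Proof.
move=> xt yt <- /(congr1 val) E H.
have l := leq_trans H (cnt_le _ _ _ _).
have := @extremal_tail t x xt; have := @extremal_tail t y ltac:(lia).
by rewrite E => Hy Hx; split; lia.
Qed.

(** As [b <= x], the first two alternatives of [extremal_left] make the left diameter exceed the
    right one by [extremal_right], and the third contradicts [x < 8 * t + 3]. *)
Lemma extremal_avoids t : 1 < t -> avoids (extremal t) t.+1 t.+1 1 (9 * t + 2).
Proof.
move=> t1 c1 c2 a b x y a0 bx xy yn H1 cx cy H2.
have L := @extremal_left t c1 a b t1 a0 H1.
have xt : 3 * t + 1 < x by lia.
have := @extremal_right t c2 x y xt _ cx cy H2.
case; lia.
Qed.

Theorem theorem4p3 (r s : nat) (hs : 3 <= s) (hsr : s <= r)
  (hr : r <= (5 * s - 1) %/ 3 - 1) :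
  f_eq s r 3 (9 * s - 7).
Proof.
split; first lia.
- apply: forces_of_not_avoids; [lia | lia |] => col.
  have -> : (9 * s - 7).+1 = 9 * s - 6 by lia.
  (* The hypothesis [hr] amounts to [3 * r <= 5 * s - 4]. *)
  apply: (@not_avoids _ col s r (@Ordinal 3 0 isT) (@Ordinal 3 1 isT)
    (@Ordinal 3 2 isT)) => //; first lia.
  by split=> // x; rewrite !inE -!val_eqE; case: (col x) => -[|[|[|]]].
move=> m _; apply: contraPT; rewrite -ltnNge => mn.
apply: (@not_forces_of_avoids 3 s r (9 * s - 8) m (extremal s.-1)); try lia.
have := @extremal_avoids s.-1 ltac:(lia).
have -> : s.-1.+1 = s by lia.
by have -> : 9 * s.-1 + 2 = (9 * s - 8).+1 by lia.
Qed.
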